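(* Let $N,k$ be positive integers with $N\ge 2k+1$, let $G$ be a connected $r$-regular graph on $m$ vertices, and let $X=C_N^k\square G$. For each $\alpha=1,\ldots,t$, assume that all roots of $D_{k,\nu_\alpha}(x)$ are simple. Then, for $a\in V(G)$ and $0\le\ell\le N-1$, we have $$h_X((0,a),(\ell,a))=\frac{2k+r}{2k}h_{C_N^k}(0,\ell)-\frac{Nm(2k+r)}{2}\sum_{\alpha=1}^{t}E_\alpha(a,a)\sum_{c=1}^{k}\frac{1}{\gamma_{\alpha,c}D_{k,\nu_\alpha}'(\phi_{\alpha,c})}\frac{V_\ell^{(\alpha,c)}V_{N-\ell}^{(\alpha,c)}}{V_N^{(\alpha,c)}}.$$
   Context: All graphs are finite, simple and undirected; $\mathbb Z_N=\mathbb Z/N\mathbb Z$. $C_N^k$ is the graph with vertex set $\mathbb Z_N$ in which $x,y$ are adjacent iff $x-y\equiv\pm s\pmod N$ for some $1\le s\le k$ (it is $2k$-regular since $N\ge 2k+1$). $X=C_N^k\square G$ is the Cartesian product: vertex set $\mathbb Z_N\times V(G)$, with $(x,a)$ and $(y,b)$ adjacent iff ($a=b$ and $x,y$ are adjacent in $C_N^k$) or ($x=y$ and $a,b$ are adjacent in $G$). For a finite connected graph $Y$ and $u,v\in V(Y)$, $h_Y(u,v)$ is the expected value of $T_v=\inf\{t\ge 0: Z_t=v\}$ for the simple random walk $(Z_t)$ on $Y$ started at $u$ (each step moves to a uniformly random neighbour). $L_G=rI_m-A_G$ is the Laplacian of $G$, with distinct eigenvalues $0=\nu_0<\nu_1<\cdots<\nu_t$;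 $E_\alpha$ is the orthogonal projection onto the $\nu_\alpha$-eigenspace, with entries $E_\alpha(a,b)$. For $\nu>0$, $D_{k,\nu}(x)=k+\frac{\nu}{2}-\sum_{s=1}^{k}T_s\left(\frac{x}{2}\right)$, where $T_s$ is the Chebyshev polynomial of the first kind; it has degree $k$. When the roots of $D_{k,\nu_\alpha}$ are simple they are denoted $\phi_{\alpha,1},\ldots,\phi_{\alpha,k}\in\mathbb C$. For each $\alpha\in\{1,\ldots,t\}$ and $c\in\{1,\ldots,k\}$ choose $\rho_{\alpha,c}\in\mathbb C$ with $\rho_{\alpha,c}+\rho_{\alpha,c}^{-1}=\phi_{\alpha,c}$, choose $\eta_{\alpha,c}\in\mathbb C$ with $\eta_{\alpha,c}^2=\rho_{\alpha,c}$, and put $\gamma_{\alpha,c}=\eta_{\alpha,c}+\eta_{\alpha,c}^{-1}$. The sequence $(V_n^{(\alpha,c)})_{n\ge 0}$ is defined by $V_0^{(\alpha,c)}=0$, $V_1^{(\alpha,c)}=1$, $V_{n+2}^{(\alpha,c)}=\gamma_{\alpha,c}V_{n+1}^{(\alpha,c)}-V_n^{(\alpha,c)}$. *)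

(* Defs.v *)
From HB Require Import structures.
From mathcomp Require Import all_boot all_order all_algebra.
From mathcomp Require Import all_classical all_reals all_analysis.
From mathcomp Require Import complex.
Set Implicit Arguments.
Unset Strict Implicit.
Unset Printing Implicit Defensive.
Import Order.TTheory GRing.Theory Num.Theory.
Local Open Scope classical_set_scope.
Local Open Scope ring_scope.

(* A finite simple graph is a symmetric irreflexive relation [e : rel V] on a
   finType [V]. *)
Definition simple_graph (V : finType) (e : rel V) : Prop :=
  symmetric e /\ irreflexive e.

Definition connected_graph (V : finType) (e : rel V) : Prop :=
  (0 < #|V|)%N /\ forall x y, fingraph.connect e x y.

Definition deg (V : finType) (e : rel V) (x : V) : nat := #|[set y | e x y]%SET|.

Definition regular_graph (V : finType) (e : rel V) (r : nat) : Prop :=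
  forall x, deg e x = r.

(* The graph C_N^k. The type 'Z_N is the ring Z/NZ only for N > 1, which
   [2 * k + 1 <= N] and [0 < k] ensure. *)
Definition circulant (N k : nat) : rel 'Z_N :=
  fun x y => [exists s : 'I_k.+1,
    (0 < s)%N && ((x - y == s%:R) || (x - y == - s%:R))].

Definition cartesian_product (V W : finType) (e : rel V) (f : rel W) :
    rel (V * W)%type :=
  fun p q => ((p.2 == q.2) && e p.1 q.1) || ((p.1 == q.1) && f p.2 q.2).

Section RandomWalk.
Context {d : measure_display} {Omega : measurableType d} {R : realType}.
Variables (P : probability Omega R) (V : finType) (e : rel V).

Definition step_prob (x y : V) : R := (e x y)%:R / (deg e x)%:R.

(* [walk_step] is the Markov property with transition probabilities
   [step_prob], with the conditioning on the past [Z_0, ..., Z_n] written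
   multiplicatively to avoid dividing by the probability of a null event. *)
Record simple_random_walk (u : V) (Z : nat -> Omega -> V) : Prop := {
  walk_measurable : forall n v, measurable [set w | Z n w = v];
  walk_start : P [set w | Z 0%N w = u] = 1%E;
  walk_step : forall (n : nat) (z : nat -> V) (y : V),
    P ([set w | forall i, (i <= n)%N -> Z i w = z i] `&`
       [set w | Z n.+1 w = y]) =
    (P [set w | forall i, (i <= n)%N -> Z i w = z i] *
     (step_prob (z n) y)%:E)%E }.

(* The value is +oo when the walk never visits [v]. *)
Definition hitting_time (Z : nat -> Omega -> V) (v : V) (w : Omega) : \bar R :=
  ereal_inf [set (t%:R : R)%:E | t in [set t : nat | Z t w = v]].

Definition expected_hitting_time (Z : nat -> Omega -> V) (v : V) : \bar R :=
  (\int[P]_w hitting_time Z v w)%E.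

End RandomWalk.

(* Matrices attached to a graph on [V] have their rows and columns indexed by
   'I_#|V| through the enumeration of [V]. *)
Definition adjacency_matrix (R : nzRingType) (V : finType) (e : rel V) :
    'M[R]_#|V| :=
  \matrix_(i, j) (e (enum_val i) (enum_val j))%:R.

Definition regular_laplacian (R : nzRingType) (V : finType) (e : rel V)
    (r : nat) : 'M[R]_#|V| :=
  r%:R%:M - adjacency_matrix R e.

Definition vertex_entry (R : Type) (V : finType) (A : 'M[R]_#|V|) (a b : V) : R :=
  A (enum_rank a) (enum_rank b).

(* [E], acting on row vectors, is the orthogonal projection onto the row space
   of [U] for the standard inner product. *)
Definition orthogonal_projection (R : fieldType) (n p : nat) (U : 'M[R]_(p, n))
    (E : 'M[R]_n) : Prop :=
  forall v : 'rV[R]_n, (v *m E <= U)%MS /\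
    forall u : 'rV[R]_n, (u <= U)%MS -> (v - v *m E) *m u^T = 0.

Fixpoint chebyshevT (F : nzRingType) (n : nat) : {poly F} :=
  match n with
  | 0 => 1
  | n1.+1 => match n1 with
             | 0 => 'X
             | n2.+1 => 2%:R *: 'X * chebyshevT F n1 - chebyshevT F n2
             end
  end.

Definition Dpoly (F : fieldType) (k : nat) (nu : F) : {poly F} :=
  (k%:R + nu / 2%:R)%:P
  - \sum_(1 <= s < k.+1) (chebyshevT F s \Po (2%:R^-1 *: 'X)).

Definition simple_roots (F : fieldType) (p : {poly F}) : Prop :=
  forall x, root p x -> mup x p = 1%N.

Fixpoint Vseq (F : nzRingType) (g : F) (n : nat) : F :=
  match n with
  | 0 => 0
  | n1.+1 => match n1 with
             | 0 => 1
             | n2.+1 => g * Vseq g n1 - Vseq g n2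
             end
  end.

(* Main.v *)
Require Import Defs.
From HB Require Import structures.
From mathcomp Require Import all_boot all_order all_algebra.
From mathcomp Require Import all_classical all_reals all_analysis.
From mathcomp Require Import complex.
From mathcomp Require Import measurable_realfun zify ring.
Set Implicit Arguments.
Unset Strict Implicit.
Unset Printing Implicit Defensive.
Import Order.TTheory GRing.Theory Num.Theory.
Import numFieldNormedType.Exports.
Local Open Scope ring_scope.
Local Open Scope complex_scope.

(* On a d-regular graph with n vertices, a function K with
   (d - A) K = delta_v - 1/n determines the hitting times of v:
   h(u, v) = n d (K(v) - K(u)). For C_N^k [] G such a K is obtained by
   separation of variables as sum_alpha E_alpha(a, b) g_alpha(x), where g_alpha
   is the Green function of 2k - A_C + nu_alpha on the cycle. With
   M = S + S^-1, S the cyclic shift, this operator is 2 D(M); a partial fraction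
   decomposition of 1/D reduces its inversion to that of the tridiagonal
   operators M - phi_c, whose Green functions are explicit in rho_c. *)

(** * Hitting times as solutions of a Dirichlet problem *)

Section HittingTimes.
Local Open Scope classical_set_scope.
Context {d : measure_display} {Omega : measurableType d} {R : realType}.
Variable P : probability Omega R.

Lemma probability_fiber_sum (T : finType) (g : Omega -> T) (A : set Omega) :
  (forall z, measurable (A `&` [set w | g w = z])) ->
  (P A = \sum_(z : T) P (A `&` [set w | g w = z]))%E.
Proof.
move=> mA.
have AE : A = \bigcup_(z in [set` enum T]) (A `&` [set w | g w = z]).
  apply/seteqP; split => [w Aw|w [z _ []]//].
  by exists (g w) => //=; rewrite mem_enum.
rewrite {1}AE measure_fin_bigcup//; last first.
  by move=> x y _ _ [w [[_ <-] [_ <-]]].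
by rewrite -fsbig_seq ?enum_uniq// big_enum.
Qed.

Definition avoids (V : eqType) (Z : nat -> Omega -> V) (v : V) (n : nat) :
    set Omega :=
  [set w | forall i, (i <= n)%N -> Z i w != v].

Lemma hitting_time_series (V : finType) (Z : nat -> Omega -> V) (v : V) w :
  hitting_time Z v w =
  (\sum_(n <oo) (\1_(avoids Z v n) w : R)%:E)%E.
Proof.
have ge0 k : (0%N <= k)%N -> (0 <= (\1_(avoids Z v k) w : R)%:E)%E.
  by move=> _; rewrite lee_fin.
have [hit|nohit] := pselect (exists t, Z t w == v); last first.
  rewrite /hitting_time (_ : [set _ | _ in _] = set0) ?ereal_inf0; last first.
    apply/seteqP; split => // x [t /= /eqP Zt _].
    by case: nohit; exists t.
  apply/esym/eqyP => A A0.
  apply: le_trans (nneseries_lim_ge (Num.truncn A).+1 _); last by move=> n /ge0.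
  rewrite (eq_bigr (fun=> 1%E)) => [|i _]; last first.
    rewrite indicE mem_set// => j _; apply/negP => Zj.
    by case: nohit; exists j.
  rewrite sumEFin lee_fin big_const_nat iter_addr addr0 subn0.
  by rewrite ltW// truncnS_gt.
case: (ex_minnP hit) => t /eqP Zt tmin.
rewrite (nneseries_split 0 t ge0) add0n [X in (_ + X)%E]eseries0 ?addr0; last first.
  move=> i ti _; rewrite indicE memNset// => /(_ _ ti).
  by rewrite Zt eqxx.
rewrite big_nat (eq_bigr (fun=> 1%E)) => [|i /andP[_ it]]; last first.
  rewrite indicE mem_set// => j ji; apply/negP => /tmin.
  by rewrite leqNgt (leq_ltn_trans ji it).
rewrite -big_nat sumEFin big_const_nat iter_addr addr0 subn0.
apply/le_anti/andP; split; first by apply: ereal_inf_lbound; exists t.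
apply: le_ereal_inf_tmp => _ [s /= /eqP Zs <-].
by rewrite lee_fin ler_nat tmin.
Qed.

Section Dirichlet.
Variables (V : finType) (e : rel V) (u v : V) (Z : nat -> Omega -> V).
Hypothesis walk : simple_random_walk P e u Z.

Let mZ n x : measurable [set w | Z n w = x].
Proof. exact: walk_measurable walk n x. Qed.

Lemma measurable_avoids n : measurable (avoids Z v n).
Proof.
rewrite (_ : avoids Z v n = \bigcap_(i in [set i | (i <= n)%N]) ~` [set w | Z i w = v]).
  by apply: bigcap_measurableType => i _; exact: measurableC.
apply/seteqP; split => w /= h i ni.
  by move=> /= /eqP; apply/negP; exact: h.
by apply/eqP => Zi; exact: h Zi.
Qed.

Let path (n : nat) (w : Omega) : {ffun 'I_n.+1 -> V} := [ffun i : 'I_n.+1 => Z i w].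

Let mpath n z : measurable [set w | path n w = z].
Proof.
rewrite (_ : [set _ | _] = \bigcap_(i in [set: 'I_n.+1]) [set w | Z i w = z i]).
  by apply: fin_bigcap_measurable.
apply/seteqP; split => w /=; first by move=> <- i _ /=; rewrite ffunE.
by move=> h; apply/ffunP => i; rewrite ffunE h.
Qed.

Let pathE n z : [set w | path n w = z] =
  [set w | forall i, (i <= n)%N -> Z i w = z (inord i)].
Proof.
apply/seteqP; split => w /=.
  by move=> <- i ni; rewrite ffunE inordK.
by move=> h; apply/ffunP => i; rewrite ffunE h ?inord_val// -ltnS.
Qed.

Let mass n y := P (avoids Z v n `&` [set w | Z n w = y]).

Lemma avoids_step n x y :
  P (avoids Z v n `&` [set w | Z n w = x] `&` [set w | Z n.+1 w = y]) =
  (mass n x * (step_prob e x y)%:E)%E.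
Proof.
have mA : measurable (avoids Z v n `&` [set w | Z n w = x]).
  by apply: measurableI => //; exact: measurable_avoids.
rewrite (probability_fiber_sum (g := path n)); last first.
  by move=> z; apply: measurableI; [exact: measurableI|exact: mpath].
rewrite /mass.
rewrite (probability_fiber_sum (g := path n) (A := _ `&` [set w | Z n w = x]));
  last first.
  by move=> z; apply: measurableI; [exact: mA|exact: mpath].
rewrite ge0_sume_distrl//.
apply: eq_bigr => z _.
have [good|bad] := pselect ((forall i, z i != v) /\ z ord_max = x); last first.
  rewrite (_ : _ `&` [set w | path n w = z] = set0); last first.
    apply/seteqP; split => // w /= [[[av Zn] _] zE]; apply: bad.
    split=> [i|]; first by rewrite -zE ffunE av// -ltnS.
    by rewrite -zE ffunE.
  rewrite (_ : _ `&` [set w | path n w = z] = set0); last first.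
    apply/seteqP; split => // w /= [[av Zn] zE]; apply: bad.
    split=> [i|]; first by rewrite -zE ffunE av// -ltnS.
    by rewrite -zE ffunE.
  by rewrite measure0 mul0e.
case: good => av zx.
have sub w : path n w = z -> avoids Z v n w /\ Z n w = x.
  move=> zE; split=> [i ni|].
    by move: (av (inord i)); rewrite -zE ffunE inordK.
  by rewrite -zx -zE ffunE.
rewrite (_ : _ `&` [set w | path n w = z] =
   [set w | path n w = z] `&` [set w | Z n.+1 w = y]); last first.
  by apply/seteqP; split => w /= => [[[_ ?] ?]//|[zE ?]]; have [] := sub _ zE.
rewrite (_ : _ `&` [set w | path n w = z] = [set w | path n w = z]); last first.
  by apply/seteqP; split => w /= => [[]//|zE]; have [] := sub _ zE.
rewrite pathE; have := walk_step walk n (fun i => z (inord i)) y => /= ->.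
by rewrite (_ : inord n = ord_max) ?zx//; apply/val_inj; rewrite /= inordK.
Qed.

Let m n y : R := fine (mass n y).

Let mass_meas n y : measurable (avoids Z v n `&` [set w | Z n w = y]).
Proof. by apply: measurableI; [exact: measurable_avoids|exact: mZ]. Qed.

Let massE n y : mass n y = (m n y)%:E.
Proof. by rewrite /m fineK// fin_num_measure. Qed.

Let m_ge0 n y : 0 <= m n y.
Proof. by rewrite fine_ge0// measure_ge0. Qed.

Let mS n y : m n.+1 y = (y != v)%:R * \sum_x m n x * step_prob e x y.
Proof.
apply: EFin_inj; rewrite -massE /mass; have [->|yv] := eqVneq y v.
  rewrite mul0r (_ : _ `&` _ = set0) ?measure0//.
  by apply/seteqP; split => // w /= [/(_ n.+1 (leqnn _))]; move=> /eqP.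
rewrite mul1r (_ : _ `&` _ = avoids Z v n `&` [set w | Z n.+1 w = y]); last first.
  apply/seteqP; split => w /= [av Zy]; split=> // i ni; first by rewrite av// ltnW.
  by move: ni; rewrite leq_eqVlt => /predU1P[->|]; [rewrite Zy|exact: av].
rewrite (probability_fiber_sum (g := Z n)); last first.
  move=> z; apply: measurableI => //; apply: measurableI => //.
  exact: measurable_avoids.
rewrite -sumEFin; apply: eq_bigr => x _.
by rewrite EFinM -massE -avoids_step setIAC.
Qed.

Let avoidsE n : P (avoids Z v n) = (\sum_y m n y)%:E.
Proof.
rewrite (probability_fiber_sum (g := Z n)) => [|z]; last exact: mass_meas.
by rewrite -sumEFin; apply: eq_bigr => y _; rewrite -massE.
Qed.

Let m0 y : m 0 y = ((y == u) && (y != v))%:R.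
Proof.
apply: EFin_inj; rewrite -massE /mass; have [->|yv] := eqVneq y v.
  rewrite andbF (_ : _ `&` _ = set0) ?measure0//.
  by apply/seteqP; split => // w /= [/(_ 0%N (leqnn _))]; move=> /eqP.
rewrite andbT (_ : _ `&` _ = [set w | Z 0%N w = y]); last first.
  apply/seteqP; split => w /= => [[]//|Zy]; split => // i.
  by rewrite leqn0 => /eqP ->; rewrite Zy.
have [->|yu] := eqVneq y u; first exact: walk_start walk.
apply/eqP; rewrite eq_le measure_ge0 andbT.
have : P (~` [set w | Z 0%N w = u]) = 0%E.
  rewrite probability_setC; last exact: mZ.
  by rewrite (walk_start walk) subee.
move=> PC0; have : (P [set w | Z 0%N w = y] <= P (~` [set w | Z 0%N w = u]))%E.
  apply: le_measure; rewrite ?inE; [exact: mZ|by apply: measurableC|].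
  by move=> w /= ->; apply/eqP.
by rewrite PC0.
Qed.

(* [E T = sum_n P (T > n)], and the n-th term is the decrease of the expectation
   of [f] over the walk killed at [v] between times n and n + 1. The sum is
   therefore bounded, so [P (T > n)] tends to 0 and the telescoping leaves
   [f u]. *)
Lemma expected_hitting_time_dirichlet (f : V -> R) :
  f v = 0 -> (forall x, x != v -> f x = 1 + \sum_y step_prob e x y * f y) ->
  expected_hitting_time P Z v = (f u)%:E.
Proof.
move=> fv fE.
pose S n : R := \sum_y m n y.
have mv n : m n v = 0.
  by case: n => [|n]; rewrite ?m0 ?mS eqxx ?andbF ?mul0r.
have start : \sum_y m 0 y * f y = f u.
  rewrite (bigD1 u)//= m0 eqxx/= big1 => [|y /negPf yu].
    by have [->|_] := eqVneq u v; rewrite ?mul0r ?mul1r addr0// fv.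
  by rewrite m0 yu mul0r.
have step n : \sum_y m n y * f y = S n + \sum_y m n.+1 y * f y.
  have -> : \sum_y m n.+1 y * f y = \sum_x m n x * \sum_y step_prob e x y * f y.
    under [RHS]eq_bigr do rewrite mulr_sumr.
    rewrite exchange_big; apply: eq_bigr => y _ /=; rewrite mS.
    have [->|yv] := eqVneq y v.
      by rewrite fv mulr0 big1// => x _; rewrite !mulr0.
    by rewrite mul1r mulr_suml; apply: eq_bigr => x _; rewrite mulrA.
  rewrite -big_split/=; apply: eq_bigr => x _.
  have [->|xv] := eqVneq x v; first by rewrite mv !mul0r addr0.
  by rewrite fE// mulrDr mulr1.
have partial n : \sum_(0 <= i < n) S i = f u - \sum_y m n y * f y.
  elim: n => [|n IH]; first by rewrite big_geq// start subrr.
  by rewrite big_nat_recr//= IH step opprD addrA addrAC subrK addrC.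
pose c : R := \sum_y `|f y|.
have tail n : `|\sum_y m n y * f y| <= c * S n.
  apply: le_trans (ler_norm_sum _ _ _) _; rewrite mulr_sumr.
  apply: ler_sum => y _; rewrite normrM ger0_norm// mulrC ler_wpM2r//.
  by rewrite /c (bigD1 y)//= lerDl sumr_ge0.
have S1 n : S n <= 1.
  by rewrite -lee_fin -avoidsE probability_le1//; exact: measurable_avoids.
have S0 n : 0 <= S n by exact: sumr_ge0.
have c0 : 0 <= c by exact: sumr_ge0.
have Scv : cvgn (series S).
  apply: nondecreasing_is_cvgn.
    by apply: nondecreasing_series => n _ _; exact: S0.
  exists (f u + c) => _ [n _ <-]; rewrite seriesEnat /= partial lerD2l.
  rewrite lerNl -[leRHS]opprK lerN2 (le_trans (ler_norm _))// normrN.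
  by rewrite (le_trans (tail n))// ler_piMr.
have rest0 : (fun n => \sum_y m n y * f y) @ \oo --> (0 : R).
  apply/norm_cvg0P.
  apply: (@squeeze_cvgr _ _ _ _ (fun=> 0) (fun n => c * S n)).
  - by apply: nearW => n; rewrite normr_ge0 tail.
  - exact: cvg_cst.
  - rewrite -[X in _ --> X](mulr0 c).
    by apply: cvgM; [exact: cvg_cst|exact: cvg_series_cvg_0].
have Slim : (fun n => \sum_(0 <= i < n) S i) @ \oo --> f u.
  under eq_fun do rewrite partial.
  have := cvgB (cvg_cst (f u)) rest0; rewrite subr0; exact.
rewrite /expected_hitting_time.
under eq_integral do rewrite hitting_time_series.
rewrite integral_nneseries//; last first.
  by move=> n; apply/measurable_EFinP; apply: measurable_indic; exact: measurable_avoids.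
have intE n : (\int[P]_w (\1_(avoids Z v n) w)%:E = (S n)%:E)%E.
  rewrite integral_indic//; last exact: measurable_avoids.
  by rewrite setIT; exact: avoidsE.
under eq_eseriesr do rewrite intE.
apply/cvg_lim => //; under eq_fun do rewrite sumEFin.
by apply: cvg_EFin; [exact: nearW|exact: Slim].
Qed.

End Dirichlet.
End HittingTimes.

(** * Laplacian of a regular graph *)

Section GraphLaplacian.
Variables (V : finType) (e : rel V) (r : nat).
Hypotheses (conn : connected_graph e) (reg : regular_graph e r).

(* Maximum principle. *)
Lemma harmonic_constant (R : realFieldType) (f : V -> R) :
  (forall x, r%:R * f x = \sum_(y | e x y) f y) -> forall x y, f x = f y.
Proof.
move=> harm; case: conn => /card_gt0P[x0 _] econn.
have [z _ zmax] := @Order.TotalTheory.arg_maxP _ _ _ x0 xpredT f isT.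
suff fz w : f w = f z by move=> x y; rewrite !fz.
have step x y : e x y -> f x = f z -> f y = f z.
  move=> xy fx; have /eqP : \sum_(y | e x y) (f z - f y) = 0.
    rewrite sumrB -harm fx sumr_const mulr_natl -(reg x) /deg cardsE.
    by rewrite (eq_card (B := [pred y | e x y])) ?subrr.
  rewrite psumr_eq0 => [|y' _]; last by rewrite subr_ge0; exact: zmax.
  by move/allP/(_ y (mem_index_enum _))/implyP/(_ xy); rewrite subr_eq0 => /eqP.
have /connectP[p] := econn z w.
elim/last_ind: p w => [|p y IH] w; first by move=> _ ->.
rewrite rcons_path last_rcons => /andP[pz py] ->.
exact: (step _ _ py (IH _ pz erefl)).
Qed.

Lemma regular_laplacianE (R : comNzRingType) (f : V -> R) (symm : symmetric e) x :
  ((\row_i f (enum_val i)) *m regular_laplacian R e r) 0 (enum_rank x) =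
  r%:R * f x - \sum_(y | e x y) f y.
Proof.
rewrite /regular_laplacian mulmxBr mul_mx_scalar !mxE enum_rankK; congr (_ - _).
rewrite (reindex_onto enum_rank enum_val)/=; last by move=> i _; exact: enum_valK.
rewrite (eq_bigl xpredT) => [|y]; last by rewrite enum_rankK eqxx.
rewrite [RHS]big_mkcond/=; apply: eq_bigr => y _; rewrite !mxE !enum_rankK symm.
by case: ifP; rewrite ?mulr1 ?mulr0.
Qed.

Lemma laplacian_row_sum (R : nzRingType) :
  regular_laplacian R e r *m const_mx 1 = 0 :> 'cV_#|V|.
Proof.
rewrite /regular_laplacian mulmxBl mul_scalar_mx.
apply/matrixP => i j; rewrite !mxE mulr1.
rewrite (reindex_onto enum_rank enum_val)/=; last by move=> k _; exact: enum_valK.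
rewrite (eq_bigl xpredT) => [|y]; last by rewrite enum_rankK eqxx.
rewrite -[in r%:R](reg (enum_val i)) /deg cardsE -sum1_card natr_sum big_mkcond/=.
rewrite -sumrB big1// => y _; rewrite !mxE enum_rankK mulr1 unfold_in.
by case: (e _ _); rewrite subrr.
Qed.

Lemma laplacian_kernel_constant (R : realFieldType) (symm : symmetric e)
    (w : 'rV[R]_#|V|) :
  w *m regular_laplacian R e r = 0 -> forall i j, w 0 i = w 0 j.
Proof.
move=> wL i j.
have := @harmonic_constant _ (fun x => w 0 (enum_rank x)) _ (enum_val i) (enum_val j).
rewrite !enum_valK; apply => x; apply/eqP; rewrite -subr_eq0.
rewrite -(regular_laplacianE _ symm) [X in X *m _](_ : _ = w) ?wL ?mxE//.
by apply/rowP => k; rewrite mxE enum_valK.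
Qed.

Lemma laplacian_green_function (R : realFieldType) (symm : symmetric e) (v : V) :
  exists g : V -> R, forall x,
    r%:R * g x - \sum_(y | e x y) g y = (x == v)%:R - #|V|%:R^-1.
Proof.
have [card_gt0 _] := conn.
have n0 : #|V|%:R != 0 :> R by rewrite pnatr_eq0 -lt0n.
pose L := regular_laplacian R e r.
pose J : 'M[R]_#|V| := const_mx 1.
pose one : 'cV[R]_#|V| := const_mx 1.
have J1 : J *m one = #|V|%:R *: one.
  apply/matrixP => i j; rewrite !mxE mulr1 (eq_bigr (fun=> 1)) => [|k _].
    by rewrite sumr_const card_ord.
  by rewrite !mxE mulr1.
have wJ (w : 'rV[R]_#|V|) : w *m one = 0 -> w *m J = 0.
  move=> w1; apply/rowP => j; rewrite !mxE.
  move/matrixP/(_ 0 0): w1; rewrite !mxE => w1.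
  by rewrite -[RHS]w1; apply: eq_bigr => k _; rewrite !mxE.
have sum0 (w : 'rV[R]_#|V|) : w *m (L + J) *m one = 0 -> w *m one = 0.
  rewrite -mulmxA mulmxDl laplacian_row_sum add0r J1 -scalemxAr => /eqP.
  by rewrite scaler_eq0 (negPf n0) => /eqP.
(* Adding the all-ones matrix removes the constants from the kernel. *)
have unitLJ : L + J \in unitmx.
  rewrite -row_free_unit; apply: inj_row_free => w wLJ.
  have w1 : w *m one = 0 by apply: sum0; rewrite wLJ mul0mx.
  have wL : w *m L = 0 by move: wLJ; rewrite mulmxDr (wJ _ w1) addr0.
  have wc := laplacian_kernel_constant symm wL.
  apply/rowP => i; rewrite mxE.
  move/matrixP/(_ 0 0): w1; rewrite !mxE (eq_bigr (fun=> w 0 i)) => [|k _].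
    rewrite sumr_const card_ord -mulr_natl => /eqP.
    by rewrite mulf_eq0 (negPf n0) => /eqP.
  by rewrite !mxE mulr1 (wc k i).
pose b : 'rV[R]_#|V| := \row_i ((enum_val i == v)%:R - #|V|%:R^-1).
pose g := b *m invmx (L + J).
have gLJ : g *m (L + J) = b by rewrite mulmxKV.
have b1 : b *m one = 0.
  apply/matrixP => i j; rewrite !mxE.
  rewrite (reindex_onto enum_rank enum_val)/=; last by move=> k _; exact: enum_valK.
  rewrite (eq_bigl xpredT) => [|y]; last by rewrite enum_rankK eqxx.
  under eq_bigr do rewrite !mxE enum_rankK mulr1.
  rewrite sumrB sumr_const -[X in _ - X]mulr_natl mulfV// (bigD1 v)//= eqxx.
  rewrite big1 ?addr0 ?subrr//.
  by move=> y /negPf ->.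
have gL : g *m L = b.
  move: (gLJ); rewrite mulmxDr (wJ g) ?addr0//.
  by apply: sum0; rewrite gLJ.
exists (fun x => g 0 (enum_rank x)) => x.
rewrite -(regular_laplacianE _ symm) [X in X *m _](_ : _ = g).
  by rewrite -/L gL mxE enum_rankK.
by apply/rowP => k; rewrite mxE enum_valK.
Qed.

End GraphLaplacian.

(** * Spectral decomposition of the Laplacian *)

Section ComplexParts.
Variable R : rcfType.

Lemma Re_sum (I : Type) (s : seq I) (P : pred I) (F : I -> R[i]) :
  complex.Re (\sum_(i <- s | P i) F i) = \sum_(i <- s | P i) complex.Re (F i).
Proof. by apply: (big_morph (@complex.Re R)) => // -[? ?] [? ?]. Qed.

Lemma Im_sum (I : Type) (s : seq I) (P : pred I) (F : I -> R[i]) :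
  complex.Im (\sum_(i <- s | P i) F i) = \sum_(i <- s | P i) complex.Im (F i).
Proof. by apply: (big_morph (@complex.Im R)) => // -[? ?] [? ?]. Qed.

Lemma ReB (x y : R[i]) : complex.Re (x - y) = complex.Re x - complex.Re y.
Proof. by case: x y => [? ?] [? ?]. Qed.

Lemma ImB (x y : R[i]) : complex.Im (x - y) = complex.Im x - complex.Im y.
Proof. by case: x y => [? ?] [? ?]. Qed.

Lemma Re_mulr_real (x : R) (z : R[i]) : complex.Re (x%:C * z) = x * complex.Re z.
Proof. by case: z => a b /=; rewrite mul0r subr0. Qed.

Lemma Im_mulr_real (x : R) (z : R[i]) : complex.Im (x%:C * z) = x * complex.Im z.
Proof. by case: z => a b /=; rewrite mul0r addr0. Qed.

End ComplexParts.

(* Over [R[i]] the matrix is unitarily diagonalizable with real eigenvalues;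
   the real and imaginary parts of its eigenvectors are real eigenvectors. *)
Lemma symmetric_eigenvectors_total (R : rcfType) (n : nat) (A : 'M[R]_n)
    (w : 'rV[R]_n) :
  A^T = A ->
  (forall (a : R) (u : 'rV[R]_n), u *m A = a *: u -> w *m u^T = 0) -> w = 0.
Proof.
move=> Asym orth.
pose toC : {rmorphism R -> R[i]} := real_complex R.
pose AC := map_mx toC A.
have hermA : AC \is hermsymmx.
  apply: realsym_hermsym.
    by apply/is_hermitianmxP; rewrite expr0 scale1r map_mx_id// map_trmx Asym.
  apply/mxOverP => i j; rewrite mxE; apply/complex_realP; by exists (A i j).
have := hermitian_normalmx hermA => /orthomx_spectralP.
have := hermitian_spectral_diag_real hermA.
have := spectral_unit AC.
set P := spectralmx AC; set sp := spectral_diag AC => Punit spreal ACE.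
have PA : P *m AC = diag_mx sp *m P.
  by rewrite [in LHS]ACE !mulmxA mulmxV// mul1mx.
suff wP : map_mx toC w *m P^T = 0.
  apply: (map_mx_inj (f := toC)); rewrite map_mx0.
  by apply: (row_free_inj (A := P^T)); rewrite ?row_free_unit ?unitmx_tr// wP mul0mx.
apply/rowP => j; rewrite !mxE.
have [a spE] : exists a, sp 0 j = toC a.
  by have /mxOverP/(_ 0 j)/complex_realP[a] := spreal; exists a.
have eigen i : \sum_k toC (A k i) * P j k = toC a * P j i.
  move/matrixP/(_ j i): PA; rewrite mul_diag_mx !mxE spE => <-.
  by apply: eq_bigr => k _; rewrite mxE mulrC.
have part (F : R[i] -> R) :
    (forall x z, F (toC x * z) = x * F z) ->
    (forall G : 'I_n -> R[i], F (\sum_i G i) = \sum_i F (G i)) ->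
    \sum_k w 0 k * F (P j k) = 0.
  move=> FZ Fsum.
  have /matrixP/(_ 0 0) : w *m (\row_k F (P j k))^T = 0.
    apply: (orth a); apply/rowP => i; rewrite !mxE -FZ -eigen Fsum.
    by apply: eq_bigr => k _; rewrite !mxE FZ mulrC.
  by rewrite !mxE => H; rewrite -[RHS]H; apply: eq_bigr => k _; rewrite !mxE.
have re0 := part _ (@Re_mulr_real R) (fun G => Re_sum _ _ G).
have im0 := part _ (@Im_mulr_real R) (fun G => Im_sum _ _ G).
apply/eqP; rewrite eq_complex Re_sum Im_sum; apply/andP; split; apply/eqP.
  by rewrite -[RHS]re0; apply: eq_bigr => k _; rewrite !mxE Re_mulr_real.
by rewrite -[RHS]im0; apply: eq_bigr => k _; rewrite !mxE Im_mulr_real.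
Qed.

Lemma eigenvectors_orthogonal (R : fieldType) (n : nat) (A : 'M[R]_n) (a b : R)
    (u v : 'rV[R]_n) :
  A^T = A -> a != b -> u *m A = a *: u -> v *m A = b *: v -> u *m v^T = 0.
Proof.
move=> Asym ab uA vA; apply/eqP.
have : a *: (u *m v^T) = b *: (u *m v^T).
  by rewrite scalemxAl -uA -mulmxA -{1}Asym -trmx_mul vA linearZ/= -scalemxAr.
move/eqP; rewrite -subr_eq0 -scalerBl scaler_eq0 subr_eq0 => /orP[|//].
by rewrite (negPf ab).
Qed.

Lemma sum_eigenprojections (R : rcfType) (n : nat) (A : 'M[R]_n) (I : finType)
    (nu : I -> R) (E : I -> 'M[R]_n) :
  A^T = A -> injective nu -> (forall x, eigenvalue A x -> exists i, x = nu i) ->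
  (forall i, orthogonal_projection (eigenspace A (nu i)) (E i)) ->
  \sum_i E i = 1%:M.
Proof.
move=> Asym nu_inj nuP hE; apply/row_matrixP => k.
rewrite !rowE mulmx1; set v := delta_mx 0 k; apply/esym/eqP; rewrite -subr_eq0.
apply/eqP/(symmetric_eigenvectors_total Asym) => a u uA.
have [->|u0] := eqVneq u 0; first by rewrite trmx0 mulmx0.
have [i ai] : exists i, a = nu i.
  by apply: nuP; apply/eigenvalueP; exists u.
rewrite mulmx_sumr (bigD1 i)//= opprD addrA mulmxBl mulmx_suml.
have [_ ->] := hE i v; last by apply/eigenspaceP; rewrite -ai.
rewrite big1 ?subr0// => j ji; apply: (eigenvectors_orthogonal (a := nu j) Asym _ _ uA).
  by rewrite ai; apply: contra ji => /eqP /nu_inj ->.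
by apply/eigenspaceP; case: (hE j v).
Qed.

Lemma eigenprojection_mul (R : fieldType) (n : nat) (A E : 'M[R]_n) (a : R) :
  orthogonal_projection (eigenspace A a) E -> E *m A = a *: E.
Proof.
move=> hE; apply/row_matrixP => k; rewrite linearZ/= !rowE mulmxA.
by apply/eigenspaceP; case: (hE (delta_mx 0 k)).
Qed.

Lemma laplacian_sym (R : nzRingType) (V : finType) (e : rel V) (r : nat) :
  symmetric e -> (regular_laplacian R e r)^T = regular_laplacian R e r.
Proof.
move=> symm; rewrite /regular_laplacian linearB/= tr_scalar_mx; congr (_ - _).
by apply/matrixP => i j; rewrite !mxE symm.
Qed.

Lemma kernel_projection_entry (R : realFieldType) (V : finType) (e : rel V)
    (r : nat) (E : 'M[R]_#|V|) (i j : 'I_#|V|) :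
  symmetric e -> connected_graph e -> regular_graph e r ->
  orthogonal_projection (eigenspace (regular_laplacian R e r) 0) E ->
  E i j = #|V|%:R^-1.
Proof.
move=> symm conn reg hE.
have EL := eigenprojection_mul hE; rewrite scale0r in EL.
have const k : E i k = E i j.
  have := @laplacian_kernel_constant _ _ r conn reg R symm (row i E) _ k j.
  by rewrite !mxE; apply; rewrite -row_mul EL row0.
have ker1 : ((const_mx 1 : 'rV[R]__) <=
    eigenspace (regular_laplacian R e r) 0)%MS.
  apply/eigenspaceP; rewrite scale0r.
  have := laplacian_row_sum reg R => /(congr1 trmx).
  by rewrite trmx_mul laplacian_sym// trmx0 trmx_const.
have [_ /(_ _ ker1)/matrixP/(_ 0 0)] := hE (delta_mx 0 i).
rewrite -rowE trmx_const.
rewrite mulmxBl !mxE (bigD1 i)//= big1 => [|k /negPf ki]; last first.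
  by rewrite !mxE eqxx ki mul0r.
rewrite !mxE !eqxx /= !mulr1 addr0 => /eqP; rewrite subr_eq0 => /eqP one.
have n0 : #|V|%:R != 0 :> R by rewrite pnatr_eq0 -lt0n; case: conn.
apply: (mulfI n0); rewrite mulfV//; apply: etrans (esym one).
rewrite (eq_bigr (fun=> E i j)) => [|k _]; last by rewrite !mxE mulr1 const.
by rewrite sumr_const card_ord mulr_natl.
Qed.

(** * Chebyshev polynomials and partial fractions *)

Section Chebyshev.
Variable F : numFieldType.

Let P (s : nat) : {poly F} := chebyshevT F s \Po (2%:R^-1 *: 'X).

Let P0 : P 0 = 1.
Proof. by rewrite /P comp_polyC. Qed.

Let P1 : P 1 = 2%:R^-1 *: 'X.
Proof. by rewrite /P comp_polyX. Qed.

Let PSS s : P s.+2 = 'X * P s.+1 - P s.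
Proof.
rewrite /P [chebyshevT F s.+2]/= comp_polyB comp_polyM comp_polyZ comp_polyX.
by rewrite scalerA divff ?pnatr_eq0// scale1r.
Qed.

(* [T_s(x/2)] turns [x + x^-1] into [(x^s + x^-s)/2], in any algebra. *)
Lemma chebyshev_rmorph (A : nzRingType) (f : {rmorphism {poly F} -> A}) (x y : A)
    (s : nat) :
  f 'X = x + y -> x * y = 1 -> y * x = 1 -> f (P s) *+ 2 = x ^+ s + y ^+ s.
Proof.
move=> fX xy yx.
suff [] : f (P s) *+ 2 = x ^+ s + y ^+ s /\ f (P s.+1) *+ 2 = x ^+ s.+1 + y ^+ s.+1.
  by [].
elim: s => [|s [IH1 IH2]].
  rewrite P0 P1 rmorph1 !expr0 !expr1 -fX -rmorphMn; split => //.
  by rewrite -scaler_nat scalerA divff ?pnatr_eq0// scale1r.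
split=> //; rewrite PSS rmorphB rmorphM fX mulrnBl -mulrnAr IH1 IH2.
rewrite mulrDl !mulrDr -!exprS (exprS y s) (exprS x s) !mulrA xy yx !mul1r.
by rewrite addrACA [y ^+ s + _]addrC addrACA addrK.
Qed.

Lemma Dpoly_rmorph (A : nzRingType) (f : {rmorphism {poly F} -> A}) (x y : A)
    (k : nat) (nu : F) :
  f 'X = x + y -> x * y = 1 -> y * x = 1 ->
  f (Dpoly k nu) *+ 2 =
  f ((2 * k)%:R + nu)%:P - \sum_(1 <= s < k.+1) (x ^+ s + y ^+ s).
Proof.
move=> fX xy yx; rewrite /Dpoly rmorphB mulrnBl; congr (_ - _).
  rewrite -rmorphMn -polyCMn; congr (f _%:P).
  by rewrite mulrnDl -[_ *+ 2 in X in _ + X]mulr_natr divfK ?pnatr_eq0// -mulrnA mulnC.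
rewrite rmorph_sum -sumrMnl; apply: eq_bigr => s _; exact: chebyshev_rmorph.
Qed.

Lemma size_Dpoly (k : nat) (nu : F) : (0 < k)%N -> size (Dpoly k nu) = k.+1.
Proof.
have sizeP s : size (P s) = s.+1 /\ size (P s.+1) = s.+2.
  elim: s => [|s [IH1 IH2]].
    by rewrite P0 P1 size_poly1 size_scale ?size_polyX// invr_eq0 pnatr_eq0.
  split=> //; rewrite PSS size_polyDl mulrC ?size_mulX -?size_poly_eq0 ?IH2//.
  by rewrite size_polyN IH1.
have sizeS j : size (\sum_(1 <= s < j.+2) P s) = j.+2.
  elim: j => [|j IH]; first by rewrite big_nat1; case: (sizeP 0).
  rewrite big_nat_recr//= addrC size_polyDl (sizeP j.+2).1 ?IH//.
case: k => // k _; rewrite /Dpoly addrC size_polyDl size_polyN sizeS//.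
exact: leq_ltn_trans (size_polyC_leq1 _) _.
Qed.

Lemma Dpoly_unit_circle (k : nat) (nu rho : F) :
  0 < nu -> `|rho| = 1 -> (Dpoly k nu).[rho + rho^-1] != 0.
Proof.
move=> nu0 rho1; have rho0 : rho != 0 by rewrite -normr_eq0 rho1 oner_eq0.
apply/eqP => D0.
have := @Dpoly_rmorph _ (horner_eval (rho + rho^-1)) rho rho^-1 k nu.
rewrite /= !horner_evalE D0 mul0rn hornerX hornerC mulfV// mulVf//.
move=> /(_ erefl erefl erefl)/esym/eqP; rewrite subr_eq0 => /eqP sumE.
have : `|(2 * k)%:R + nu| <= (2 * k)%:R :> F.
  rewrite sumE; apply: le_trans (ler_norm_sum _ _ _) _.
  apply: (@le_trans _ _ (\sum_(1 <= s < k.+1) 2%:R)).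
    apply: ler_sum => s _; apply: le_trans (ler_normD _ _) _.
    by rewrite !normrX normfV rho1 invr1 !expr1n.
  by rewrite sumr_const_nat subn1 -mulrnA.
rewrite ger0_norm; last by rewrite addr_ge0 ?ler0n ?ltW.
by rewrite gerDl => /(lt_le_trans nu0); rewrite ltxx.
Qed.

End Chebyshev.

Section PartialFractions.
Variables (F : fieldType) (k : nat) (p : {poly F}) (phi : 'I_k -> F).
Hypotheses (k_gt0 : (0 < k)%N) (sp : size p = k.+1) (phi_inj : injective phi).
Hypothesis rootp : forall c, root p (phi c).

Let q c := p %/ ('X - (phi c)%:P).

Let pE c : p = q c * ('X - (phi c)%:P).
Proof. by rewrite divpK// dvdp_XsubCl. Qed.

Let size_q c : size (q c) = k.
Proof. by rewrite size_divp ?polyXsubC_eq0// size_XsubC sp subn1. Qed.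

Let q_other c c' : c' != c -> (q c).[phi c'] = 0.
Proof.
move=> cc; have := rootp c'; rewrite /root {1}(pE c) hornerM !hornerE mulf_eq0.
by rewrite subr_eq0 (inj_eq phi_inj) (negPf cc) orbF => /eqP.
Qed.

Let qE c : (q c).[phi c] = p^`().[phi c].
Proof. by rewrite [in RHS](pE c) derivM derivXsubC !hornerE subrr mulr0 add0r. Qed.

Let vanish (s : {poly F}) : (size s <= k)%N -> (forall c, s.[phi c] = 0) -> s = 0.
Proof.
move=> ss s0; apply: (@roots_geq_poly_eq0 _ s (map phi (enum 'I_k))).
- by apply/allP => _ /mapP[c _ ->]; rewrite /root s0.
- by rewrite map_inj_uniq// enum_uniq.
- by rewrite size_map size_enum_ord.
Qed.

Lemma deriv_root_neq0 c : p^`().[phi c] != 0.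
Proof.
rewrite -qE; apply/eqP => qc0.
have q0 : q c = 0.
  apply: vanish => [|c']; first by rewrite size_q.
  by have [->//|cc] := eqVneq c' c; exact: q_other.
by move: k_gt0; rewrite -(size_q c) q0 size_poly0.
Qed.

Lemma partial_fractions :
  \sum_c (p^`().[phi c])^-1 *: (p %/ ('X - (phi c)%:P)) = 1.
Proof.
apply/eqP; rewrite -subr_eq0; apply/eqP/vanish => [|c].
  rewrite (leq_trans (size_polyD _ _))// geq_max size_polyN size_poly1 k_gt0 andbT.
  rewrite (leq_trans (size_sum _ _ _))//; apply/bigmax_leqP => c _.
  by rewrite (leq_trans (size_scale_leq _ _))// -/(q c) size_q.
rewrite !hornerE horner_sum (bigD1 c)//= big1 => [|c' cc].
  by rewrite hornerZ -/(q c) qE mulVf ?deriv_root_neq0// addr0 subrr.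
by rewrite hornerZ -/(q c') q_other ?mulr0// eq_sym.
Qed.

End PartialFractions.

(** * The graph C_N^k and its Green function *)

Section Circulant.
Variables (N k : nat).
Hypotheses (k_gt0 : (0 < k)%N) (kN : (2 * k + 1 <= N)%N).

Let N_gt1 : (1 < N)%N.
Proof. by lia. Qed.

Lemma Zp_nat_inj (i j : nat) :
  (i < N)%N -> (j < N)%N -> (i%:R : 'Z_N) = j%:R -> i = j.
Proof. by move=> iN jN /(congr1 val) /=; rewrite !val_Zp_nat// !modn_small. Qed.

Lemma circulant_sum (M : nmodType) (f : 'Z_N -> M) (x : 'Z_N) :
  \sum_(y | circulant k x y) f y =
  \sum_(1 <= s < k.+1) (f (x + s%:R) + f (x - s%:R)).
Proof.
pose nbrs := [seq x + s%:R | s <- index_iota 1 k.+1] ++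
             [seq x - s%:R | s <- index_iota 1 k.+1].
have iotaP s : s \in index_iota 1 k.+1 -> (0 < s < k.+1)%N by rewrite mem_index_iota.
rewrite big_split/= -(big_map _ xpredT f) -(big_map (fun s => x - s%:R) xpredT f).
rewrite -big_cat -/nbrs.
have uniq_nbrs : uniq nbrs.
  rewrite cat_uniq !map_inj_in_uniq ?iota_uniq ?andbT/=; last 2 first.
  - move=> i j /iotaP ? /iotaP ? /addrI /oppr_inj; apply: Zp_nat_inj; lia.
  - move=> i j /iotaP ? /iotaP ? /addrI; apply: Zp_nat_inj; lia.
  apply/hasPn => _ /mapP[i /iotaP ? ->]; apply/mapP => -[j /iotaP ? /addrI].
  move/eqP; rewrite eq_sym -addr_eq0 -natrD => /eqP ji0.
  have : (j + i)%N = 0%N by apply: Zp_nat_inj; [lia|lia|rewrite ji0].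
  lia.
rewrite big_uniq//=; apply: eq_bigl => y.
rewrite mem_cat /circulant; apply/existsP/orP.
  move=> [s /andP[s0 /orP[/eqP xy|/eqP xy]]]; [right|left]; apply/mapP.
    by exists (val s); rewrite ?mem_index_iota ?s0 ?ltn_ord// -xy opprB addrC subrK.
  exists (val s); rewrite ?mem_index_iota ?s0 ?ltn_ord//.
  by rewrite -[s%:R]opprK -xy opprB addrC subrK.
move=> [] /mapP[s /iotaP/andP[s0 sk] ->]; exists (Ordinal sk); rewrite /= s0/=.
  by rewrite opprD addrA subrr add0r eqxx orbT.
by rewrite opprB addrC subrK eqxx.
Qed.

Lemma circulant_regular : regular_graph (@circulant N k) (2 * k).
Proof.
move=> x; rewrite /deg cardsE -sum1_card.
rewrite (eq_bigl (fun y => circulant k x y)) => [|y]; last by rewrite unfold_in.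
rewrite circulant_sum big_split/= !sum_nat_const_nat subn1; lia.
Qed.

Lemma circulant_sym : symmetric (@circulant N k).
Proof.
move=> x y; rewrite /circulant; apply: eq_existsb => s; congr (_ && _).
by rewrite -(opprB y x) eqr_opp eqr_oppLR orbC.
Qed.

Lemma circulant_connected : connected_graph (@circulant N k).
Proof.
split; first by rewrite card_ord.
have conn0 (y : 'Z_N) : fingraph.connect (@circulant N k) 0 y.
  rewrite -(natr_Zp y); elim: (val y) => [|m IH]; first exact: connect0.
  apply: connect_trans IH (connect1 _); apply/existsP.
  exists (Ordinal (k_gt0 : (1 < k.+1)%N)); rewrite /= -natr1.
  by rewrite opprD addrA subrr add0r eqxx orbT.
move=> x y; apply: connect_trans (conn0 y).
by rewrite sym_connect_sym//; exact: circulant_sym.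
Qed.

Lemma circulant_irreflexive : irreflexive (@circulant N k).
Proof.
move=> x; apply/existsP => -[s /andP[s0]]; rewrite subrr.
rewrite eq_sym [0 == _]eq_sym oppr_eq0 orbb => /eqP s0N.
have : (s : nat) = 0%N by apply: Zp_nat_inj; [have := ltn_ord s; lia|lia|rewrite s0N].
by move=> s00; rewrite s00 in s0.
Qed.

Lemma circulant_sum_reflect (M : nmodType) (f : 'Z_N -> M) (l x : 'Z_N) :
  \sum_(y | circulant k x y) f (l - y) = \sum_(y | circulant k (l - x) y) f y.
Proof.
rewrite !circulant_sum; apply: eq_bigr => s _.
rewrite addrC; congr (f _ + f _); last by rewrite opprD addrA.
by rewrite opprB addrCA addrC.
Qed.

End Circulant.

Section CirculantGreen.
Variables (F : numFieldType) (n k : nat).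
Local Notation N := n.+2.

Definition shift_mx (a : 'I_N) : 'M[F]_N := \matrix_(i, j) (j == i + a)%:R.

Lemma shift_mx_mul (a : 'I_N) (q : 'cV[F]_N) i : (shift_mx a *m q) i 0 = q (i + a) 0.
Proof.
rewrite mxE (bigD1 (i + a))//= big1 => [|j /negPf ji]; last by rewrite mxE ji mul0r.
by rewrite mxE eqxx mul1r addr0.
Qed.

Lemma shift_mxD (a b : 'I_N) : shift_mx a * shift_mx b = shift_mx (a + b).
Proof.
apply/matrixP => i j; rewrite mxE (bigD1 (i + a))//= big1 => [|l /negPf li].
  by rewrite !mxE eqxx mul1r addr0 addrA.
by rewrite mxE li mul0r.
Qed.

Lemma shift_mx0 : shift_mx 0 = 1.
Proof. by apply/matrixP => i j; rewrite !mxE addr0 eq_sym. Qed.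

Lemma shift_mxX (a : 'I_N) s : shift_mx a ^+ s = shift_mx (a *+ s).
Proof.
elim: s => [|s IH]; first by rewrite mulr0n shift_mx0.
by rewrite exprS IH shift_mxD -mulrS.
Qed.

(* Solves [q (x + 1) + q (x - 1) - (rho + rho^-1) q x = (x == 0)] around the
   cycle: both [rho ^ x] and [rho ^ (N - x)] are homogeneous solutions on
   [0..N], and their sum takes equal values at both ends. *)
Definition cycle_green (rho : F) (x : nat) : F :=
  (rho ^+ x + rho ^+ (N - x)) / ((rho - rho^-1) * (1 - rho ^+ N)).

Lemma cycle_greenP (rho : F) (i : 'I_N) :
  rho != 0 -> rho - rho^-1 != 0 -> 1 - rho ^+ N != 0 ->
  cycle_green rho (i + 1)%R + cycle_green rho (i - 1)%R
  - (rho + rho^-1) * cycle_green rho i = (i == 0)%:R.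
Proof.
move=> rho0 r1 r2.
have succE : cycle_green rho (i + 1)%R = cycle_green rho i.+1.
  rewrite /= (@modn_small 1)// addn1; have := ltn_ord i.
  rewrite leq_eqVlt => /predU1P[->|iN]; last by rewrite modn_small.
  by rewrite modnn /cycle_green subnn subn0 addrC.
have predE : cycle_green rho (i - 1)%R =
    cycle_green rho (if nat_of_ord i is j.+1 then j else 1%N).
  have [i0|i0] := eqVneq i 0.
    rewrite i0 sub0r /= (@modn_small 1)// subn1 modn_small//=.
    by rewrite /cycle_green subSn// subnn subn1/= addrC.
  congr (cycle_green rho _).
  have : nat_of_ord i != 0%N by [].
  rewrite /= (@modn_small 1)// subn1/= (@modn_small n.+1)//.
  have := ltn_ord i; case: (nat_of_ord i) => // j jN _.
  by rewrite addSnnS modnDr modn_small// ltnW.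
rewrite succE predE /cycle_green !mulrA -mulrDl -mulrBl.
have den0 : (rho - rho^-1) * (1 - rho ^+ N) != 0 by rewrite mulf_neq0.
move: (ltn_ord i); case ij: (nat_of_ord i) => [|j] jN /=.
  rewrite (_ : i = 0) ?eqxx; last exact/val_inj.
  rewrite -[RHS](divff den0); congr (_ / _); rewrite subn0 subn1/=.
  by rewrite [rho ^+ N]exprS expr0 expr1; field.
rewrite (_ : i == 0 = false); last by rewrite -val_eqE/= ij.
have -> : (N - j.+2 = n - j)%N by lia.
have -> : (N - j.+1 = (n - j).+1)%N by lia.
have -> : (N - j = (n - j).+2)%N by lia.
rewrite -[RHS](mul0r ((rho - rho^-1) * (1 - rho ^+ N))^-1); congr (_ * _).
by rewrite !exprS; field.
Qed.

Hypotheses (k_gt0 : (0 < k)%N) (kN : (2 * k + 1 <= N)%N).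
Variables (nu : F) (phi rho : 'I_k -> F).
Hypotheses (nu_gt0 : 0 < nu) (phi_inj : injective phi).
Hypothesis rootP : forall c, root (Dpoly k nu) (phi c).
Hypotheses (rho0 : forall c, rho c != 0)
  (rhoE : forall c, rho c + (rho c)^-1 = phi c).

Definition circulant_green (x : nat) : F :=
  2%:R^-1 * \sum_c ((Dpoly k nu)^`().[phi c])^-1 * cycle_green (rho c) x.

Lemma rho_not_root_of_unity c m : (0 < m)%N -> rho c ^+ m != 1.
Proof.
move=> m0; apply/eqP => rm.
have /(@Dpoly_unit_circle F k nu (rho c) nu_gt0) : `|rho c| = 1.
  apply/eqP; rewrite -(@pexpr_eq1 _ `|rho c| m)// -normrX rm normr1//.
by rewrite rhoE; have := rootP c; rewrite /root => ->.
Qed.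

Lemma rho_sub_inv_neq0 c : rho c - (rho c)^-1 != 0.
Proof.
rewrite -(inj_eq (mulfI (rho0 c))) mulr0 mulrBr mulfV// subr_eq0.
by rewrite (rho_not_root_of_unity c (m := 2)).
Qed.

Lemma circulant_greenP (x : 'I_N) :
  ((2 * k)%:R + nu) * circulant_green x
  - \sum_(y : 'Z_N | circulant k (x : 'Z_N) y) circulant_green y = (x == 0)%:R.
Proof.
pose M := shift_mx 1 + shift_mx (-1).
pose q c : 'cV[F]_N := \col_i cycle_green (rho c) i.
pose delta : 'cV[F]_N := \col_i (i == 0)%:R.
have Mq c : (M - (phi c)%:M) *m q c = delta.
  apply/colP => i; rewrite mulmxBl mulmxDl mul_scalar_mx.
  rewrite mxE [X in X + _]mxE !shift_mx_mul !mxE -rhoE cycle_greenP ?rho_sub_inv_neq0//.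
  by rewrite subr_eq0 eq_sym rho_not_root_of_unity.
have xy : shift_mx 1 * shift_mx (-1) = 1 by rewrite shift_mxD subrr shift_mx0.
have yx : shift_mx (-1) * shift_mx 1 = 1 by rewrite shift_mxD addNr shift_mx0.
pose D := Dpoly k nu.
pose G : 'cV[F]_N := \sum_c (D^`().[phi c])^-1 *: q c.
have DG : horner_mx M D *m G = delta.
  rewrite /G mulmx_sumr.
  have step c : horner_mx M D *m ((D^`().[phi c])^-1 *: q c) =
      horner_mx M ((D^`().[phi c])^-1 *: (D %/ ('X - (phi c)%:P))) *m delta.
    have {1}-> : D = D %/ ('X - (phi c)%:P) * ('X - (phi c)%:P).
      by rewrite divpK// dvdp_XsubCl rootP.
    rewrite rmorphM/= rmorphB/= horner_mx_X horner_mx_C -mulmxA -scalemxAr Mq.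
    by rewrite -scalemxAr [in RHS]linearZ/= -scalemxAl.
  under eq_bigr do rewrite step.
  rewrite -mulmx_suml -rmorph_sum/= partial_fractions ?size_Dpoly//.
  by rewrite rmorph1 mul1mx.
have GE (i : 'I_N) : circulant_green i = 2%:R^-1 * G i 0.
  rewrite /circulant_green /G summxE; congr (_ * _).
  by apply: eq_bigr => c _; rewrite !mxE.
clearbody G.
have := Dpoly_rmorph k nu (f := horner_mx M) (horner_mx_X M) xy yx.
move=> /(congr1 (fun B : 'M[F]_N => (B *m G) x 0)).
have -> : ((horner_mx M D *+ 2) *m G) x 0 = (x == 0)%:R * 2%:R.
  by rewrite mulr2n mulmxDl DG !mxE mulr_natr mulr2n.
rewrite /= horner_mx_C mulmxBl mul_scalar_mx mulmx_suml.
move=> DGx; rewrite mxE [X in _ = X + _]mxE [X in _ = _ + X]mxE summxE in DGx.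
rewrite (circulant_sum k_gt0 kN) GE.
have two0 : 2%:R != 0 :> F by rewrite pnatr_eq0.
apply: (mulIf two0); rewrite DGx mulrBl; congr (_ - _).
  by rewrite mulrCA mulrC mulVKf.
rewrite mulr_suml; apply: eq_bigr => s _.
rewrite mulmxDl mxE !shift_mxX !shift_mx_mul !GE -mulrDr mulrC mulVKf//.
by rewrite mulNrn.
Qed.

End CirculantGreen.

Lemma Vseq_closed (F : fieldType) (eta : F) (m : nat) : eta != 0 ->
  Vseq (eta + eta^-1) m * (eta - eta^-1) = eta ^+ m - eta ^- m.
Proof.
move=> eta0.
suff [] : Vseq (eta + eta^-1) m * (eta - eta^-1) = eta ^+ m - eta ^- m /\
  Vseq (eta + eta^-1) m.+1 * (eta - eta^-1) = eta ^+ m.+1 - eta ^- m.+1 by [].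
elim: m => [|m [IH1 IH2]].
  by split; rewrite /= ?mul0r ?expr0 ?invr1 ?subrr// mul1r expr1.
split=> //; rewrite [Vseq _ m.+2]/= mulrBl -mulrA IH2 IH1 !exprS.
have := expf_neq0 m eta0; set X := eta ^+ m => X0.
by field; rewrite X0.
Qed.

Lemma cycle_green_diff (F : numFieldType) (n l : nat) (rho eta gam : F) :
  (l <= n.+2)%N -> rho != 0 -> eta ^+ 2 = rho -> gam = eta + eta^-1 ->
  rho - rho^-1 != 0 -> 1 - rho ^+ n.+2 != 0 ->
  cycle_green n rho 0 - cycle_green n rho l =
  - (gam^-1 * (Vseq gam l * Vseq gam (n.+2 - l) / Vseq gam n.+2)).
Proof.
move=> lN rho0 etaE -> r1 r2.
have eta0 : eta != 0 by apply: contraNneq rho0 => eta0; rewrite -etaE eta0 expr0n.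
have etaV : (eta - eta^-1) * (eta + eta^-1) = rho - rho^-1.
  by rewrite -etaE; field.
have [e1 e2] : eta - eta^-1 != 0 /\ eta + eta^-1 != 0.
  by move: r1; rewrite -etaV mulf_eq0 negb_or => /andP.
have VE m : Vseq (eta + eta^-1) m = (eta ^+ m - eta ^- m) / (eta - eta^-1).
  by rewrite -Vseq_closed// mulfK.
rewrite !VE /cycle_green subn0 expr0 -etaV.
have -> : eta ^+ n.+2 = eta ^+ l * eta ^+ (n.+2 - l) by rewrite -exprD subnKC.
move: r2; have -> : rho ^+ n.+2 = (eta ^+ l) ^+ 2 * (eta ^+ (n.+2 - l)) ^+ 2.
  by rewrite -exprMn -exprD subnKC// -etaE -!exprM mulnC.
have rhoX m : rho ^+ m = (eta ^+ m) ^+ 2 by rewrite -etaE -!exprM mulnC.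
rewrite !rhoX; move: e1 e2; clear etaV r1 VE rhoX.
have := expf_neq0 l eta0; have := expf_neq0 (n.+2 - l) eta0.
set A := eta ^+ l; set B := eta ^+ (n.+2 - l) => B0 A0 e1 e2 r2.
have m1 : eta * eta - 1 != 0.
  by rewrite (_ : _ - 1 = (eta - eta^-1) * eta) ?mulf_neq0//; field.
have p1 : eta * eta + 1 != 0.
  by rewrite (_ : _ + 1 = (eta + eta^-1) * eta) ?mulf_neq0//; field.
have AB1 : 1 - (A * B) ^+ 2 != 0 by rewrite exprMn.
by field; rewrite eta0 A0 B0 m1 p1 AB1 -opprB oppr_eq0 -expr2 AB1.
Qed.

Lemma circulant_green_diff (F : numFieldType) (n k l : nat) (nu : F)
    (phi rho eta gam : 'I_k -> F) :
  (l <= n.+2)%N -> 0 < nu -> (forall c, root (Dpoly k nu) (phi c)) ->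
  (forall c, rho c != 0) -> (forall c, rho c + (rho c)^-1 = phi c) ->
  (forall c, eta c ^+ 2 = rho c) -> (forall c, gam c = eta c + (eta c)^-1) ->
  circulant_green n nu phi rho 0 - circulant_green n nu phi rho l =
  - (2%:R^-1 * \sum_c 1 / (gam c * (Dpoly k nu)^`().[phi c]) *
       (Vseq (gam c) l * Vseq (gam c) (n.+2 - l) / Vseq (gam c) n.+2)).
Proof.
move=> lN nu0 rootP rho0 rhoE etaE gamE.
rewrite /circulant_green -mulrBr -mulrN -sumrB -sumrN; congr (_ * _).
apply: eq_bigr => c _; rewrite -mulrBr.
rewrite (cycle_green_diff lN (rho0 c) (etaE c) (gamE c)); last 2 first.
- by rewrite (rho_sub_inv_neq0 nu0 rootP rho0 rhoE).
- by rewrite subr_eq0 eq_sym (rho_not_root_of_unity nu0 rootP rhoE).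
by rewrite div1r invfM [_ ^-1 * (_)^-1]mulrC mulrN -!mulrA.
Qed.

(** * Hitting times from Green functions, and Cartesian products *)

Section GreenHitting.
Context {d : measure_display} {Omega : measurableType d} {R : realType}.
Variables (P : probability Omega R) (V : finType) (e : rel V) (u v : V).
Variables (Z : nat -> Omega -> V) (r : nat).
Hypotheses (walk : simple_random_walk P e u Z) (reg : regular_graph e r).
Hypothesis r_gt0 : (0 < r)%N.

Let regular_dirichlet (f : V -> R) :
  f v = 0 -> (forall x, x != v -> r%:R * f x - \sum_(y | e x y) f y = r%:R) ->
  expected_hitting_time P Z v = (f u)%:E.
Proof.
move=> fv fE; apply: (expected_hitting_time_dirichlet walk fv) => x xv.
have r0 : r%:R != 0 :> R by rewrite pnatr_eq0 -lt0n.
apply: (mulfI r0); rewrite mulrDr mulr1.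
have /eqP := fE x xv; rewrite subr_eq => /eqP ->; congr (_ + _).
rewrite mulr_sumr big_mkcond/=; apply: eq_bigr => y _; rewrite /step_prob reg.
by case: (e x y); rewrite /= ?mul0r ?mulr0// mul1r mulVKf.
Qed.

(* [Re f] and [Re f + Im f] both solve the real Dirichlet problem satisfied by
   the hitting times, so [Im (f u) = 0] although [K] is complex. *)
Lemma hitting_time_green (K : V -> R[i]) :
  (forall x, r%:R * K x - \sum_(y | e x y) K y = (x == v)%:R - #|V|%:R^-1) ->
  exists2 h : R, expected_hitting_time P Z v = h%:E &
    h%:C = #|V|%:R * r%:R * (K v - K u).
Proof.
move=> KE; pose f x := #|V|%:R * r%:R * (K v - K x).
have V0 : #|V|%:R != 0 :> R[i].
  by rewrite pnatr_eq0 -lt0n; apply/card_gt0P; exists u.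
have fv : f v = 0 by rewrite /f subrr mulr0.
have fE x : x != v -> r%:R * f x - \sum_(y | e x y) f y = r%:R.
  move=> /negPf xv; have := KE x; rewrite xv sub0r => KxE.
  have KsE : \sum_(y | e x y) K y = r%:R * K x + #|V|%:R^-1.
    by rewrite -[#|V|%:R^-1]opprK -KxE opprB addrC subrK.
  rewrite /f -mulr_sumr sumrB KsE sumr_const -[K v *+ _]mulr_natl.
  have -> : #|e x| = r by rewrite -(reg x) /deg cardsE.
  by field.
have natC : r%:R = (r%:R : R)%:C by rewrite rmorph_nat.
have ReE x : x != v ->
    r%:R * complex.Re (f x) - \sum_(y | e x y) complex.Re (f y) = r%:R.
  move=> xv; have /(congr1 (@complex.Re R)) := fE x xv.
  by rewrite natC ReB Re_mulr_real Re_sum.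
have ImE x : x != v ->
    r%:R * complex.Im (f x) - \sum_(y | e x y) complex.Im (f y) = 0.
  move=> xv; have /(congr1 (@complex.Im R)) := fE x xv.
  by rewrite natC ImB Im_mulr_real Im_sum.
have hRe := @regular_dirichlet (fun x => complex.Re (f x)) _ ReE.
have hReIm := @regular_dirichlet (fun x => complex.Re (f x) + complex.Im (f x)) _ _.
exists (complex.Re (f u)); first by rewrite hRe// fv.
have : (complex.Re (f u))%:E = (complex.Re (f u) + complex.Im (f u))%:E.
  rewrite -hRe ?fv// -hReIm ?fv ?addr0// => x xv.
  by rewrite big_split/= mulrDr opprD addrACA ReE// ImE// addr0.
move=> [/eqP]; rewrite -{1}[complex.Re (f u)]addr0 (inj_eq (addrI _)) => /eqP Im0.
by rewrite -/(f u); case: (f u) Im0 => a b /= <-.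
Qed.

End GreenHitting.

Lemma cartesian_product_sum (V W : finType) (M : nmodType) (e : rel V) (f : rel W)
    (F : V * W -> M) (p : V * W) :
  irreflexive e ->
  \sum_(q | cartesian_product e f p q) F q =
  \sum_(y | e p.1 y) F (y, p.2) + \sum_(c | f p.2 c) F (p.1, c).
Proof.
move=> irr; case: p => x b /=.
rewrite [in RHS]big_mkcond [X in _ + X]big_mkcond/=.
have -> : \sum_y (if e x y then F (y, b) else 0) =
    \sum_q (if (b == q.2) && e x q.1 then F q else 0).
  transitivity (\sum_y \sum_c (if (b == c) && e x y then F (y, c) else 0)).
    2: by rewrite pair_bigA; apply: eq_bigr => -[].
  apply: eq_bigr => y _; rewrite (bigD1 b)//= eqxx/= big1 ?addr0// => c /negPf cb.
  by rewrite eq_sym cb.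
have -> : \sum_c (if f b c then F (x, c) else 0) =
    \sum_q (if (x == q.1) && f b q.2 then F q else 0).
  transitivity (\sum_y \sum_c (if (x == y) && f b c then F (y, c) else 0)).
    2: by rewrite pair_bigA; apply: eq_bigr => -[].
  rewrite (bigD1 x)//= [X in _ = _ + X]big1 ?addr0 => [|y /negPf yx]; last first.
    by rewrite big1// => c _; rewrite eq_sym yx.
  by apply: eq_bigr => c _; rewrite eqxx.
rewrite big_mkcond -big_split/=; apply: eq_bigr => -[y c] _ /=.
rewrite /cartesian_product/=; case: (eqVneq x y) => [<-|_].
  by rewrite irr andbF /= add0r.
by rewrite orbF addr0.
Qed.

Lemma cartesian_product_regular (V W : finType) (e : rel V) (f : rel W) (j r : nat) :
  irreflexive e -> regular_graph e j -> regular_graph f r ->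
  regular_graph (cartesian_product e f) (j + r).
Proof.
move=> irr re rf p.
have degE (U : finType) (g : rel U) x : deg g x = \sum_(y | g x y) 1%N.
  by rewrite sum1_card /deg cardsE.
by rewrite degE (cartesian_product_sum _ _ _ irr)/= -!degE re rf.
Qed.

Lemma product_green (R : rcfType) (U V : finType) (f : rel U) (e : rel V)
    (j r t : nat) (nu : 'I_t.+1 -> R) (E : 'I_t.+1 -> 'M[R]_#|V|)
    (g : 'I_t.+1 -> U -> R[i]) (o : U) (a : V) (p : U * V) :
  irreflexive f -> symmetric e -> connected_graph e -> regular_graph e r ->
  nu ord0 = 0 -> injective nu ->
  (forall y, eigenvalue (regular_laplacian R e r) y -> exists al, y = nu al) ->
  (forall al,
     orthogonal_projection (eigenspace (regular_laplacian R e r) (nu al)) (E al)) ->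
  (forall al y, (j%:R + (nu al)%:C) * g al y - \sum_(z | f y z) g al z =
     (y == o)%:R - (al == ord0)%:R / #|U|%:R) ->
  let K q := \sum_al (vertex_entry (E al) a q.2)%:C * g al q.1 in
  (j + r)%:R * K p - \sum_(q | cartesian_product f e p q) K q =
  (p == (o, a))%:R - #|{: U * V}|%:R^-1.
Proof.
move=> irr symm conn reg nu0 nu_inj nuP hE gE K; case: p => x b.
have entry_sum al : \sum_(c | e b c) vertex_entry (E al) a c =
    (r%:R - nu al) * vertex_entry (E al) a b.
  have /rowP/(_ (enum_rank b)) : row (enum_rank a) (E al) *m regular_laplacian R e r =
      nu al *: row (enum_rank a) (E al).
    by rewrite -row_mul (eigenprojection_mul (hE al)) linearZ.
  rewrite [X in X *m _](_ : _ = \row_i vertex_entry (E al) a (enum_val i)); last first.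
    by apply/rowP => i; rewrite !mxE /vertex_entry enum_valK.
  rewrite regular_laplacianE// !mxE -/(vertex_entry (E al) a b) mulrBl => <-.
  by rewrite opprB addrC subrK.
have total : \sum_al vertex_entry (E al) a b = (b == a)%:R.
  have /matrixP/(_ (enum_rank a) (enum_rank b)) :=
    sum_eigenprojections (laplacian_sym R r symm) nu_inj nuP hE.
  by rewrite summxE mxE (inj_eq enum_rank_inj) eq_sym.
have E0 : vertex_entry (E ord0) a b = #|V|%:R^-1.
  by apply: (kernel_projection_entry _ _ symm conn reg); rewrite -nu0.
rewrite cartesian_product_sum// /K /= mulr_sumr.
rewrite exchange_big/= [X in _ - (_ + X)]exchange_big/= -big_split -sumrB/=.
have term al : (j + r)%:R * ((vertex_entry (E al) a b)%:C * g al x) -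
    (\sum_(y | f x y) (vertex_entry (E al) a b)%:C * g al y +
     \sum_(c | e b c) (vertex_entry (E al) a c)%:C * g al x) =
    (vertex_entry (E al) a b)%:C * ((x == o)%:R - (al == ord0)%:R / #|U|%:R).
  rewrite -mulr_sumr -mulr_suml -rmorph_sum entry_sum -gE.
  rewrite rmorphM rmorphB rmorph_nat natrD.
  by ring.
under eq_bigr do rewrite term mulrBr.
rewrite sumrB -mulr_suml -rmorph_sum total; congr (_ - _).
  by rewrite rmorph_nat -natrM mulnb xpair_eqE andbC.
rewrite (bigD1 ord0)//= big1 => [|al /negPf ->]; last by rewrite mul0r mulr0.
by rewrite E0 mul1r addr0 fmorphV rmorph_nat card_prod natrM invfM mulrC.
Qed.

Theorem theorem4p10
  (R : realType) (N k r : nat) (V : finType) (e : rel V)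
  (hN : (0 < N)%N) (hk : (0 < k)%N) (hNk : (2 * k + 1 <= N)%N)
  (hG : simple_graph e) (hGc : connected_graph e) (hGr : regular_graph e r)
  (t : nat) (nu : 'I_t.+1 -> R) (E : 'I_t.+1 -> 'M[R]_#|V|)
  (hnu0 : nu ord0 = 0)
  (hnu_lt : forall al be : 'I_t.+1, (al < be)%N -> nu al < nu be)
  (hnu : forall x : R,
     eigenvalue (regular_laplacian R e r) x <-> exists al, x = nu al)
  (hE : forall al,
     orthogonal_projection (eigenspace (regular_laplacian R e r) (nu al)) (E al))
  (hD : forall al : 'I_t.+1, (0 < al)%N -> simple_roots (Dpoly k (nu al)%:C))
  (phi rho eta gam : 'I_t.+1 -> 'I_k -> R[i])
  (hphi_inj : forall al : 'I_t.+1, (0 < al)%N -> injective (phi al))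
  (hphi : forall al : 'I_t.+1, (0 < al)%N -> forall x : R[i],
     root (Dpoly k (nu al)%:C) x <-> exists c, x = phi al c)
  (hrho0 : forall (al : 'I_t.+1) (c : 'I_k), (0 < al)%N -> rho al c != 0)
  (hrho : forall (al : 'I_t.+1) (c : 'I_k), (0 < al)%N ->
     rho al c + (rho al c)^-1 = phi al c)
  (heta : forall (al : 'I_t.+1) (c : 'I_k), (0 < al)%N ->
     eta al c ^+ 2 = rho al c)
  (hgam : forall (al : 'I_t.+1) (c : 'I_k), (0 < al)%N ->
     gam al c = eta al c + (eta al c)^-1)
  (a : V) (l : nat) (hl : (l <= N - 1)%N)
  (dX : measure_display) (OX : measurableType dX) (PX : probability OX R)
  (ZX : nat -> OX -> 'Z_N * V)
  (hZX : simple_random_walk PX (cartesian_product (@circulant N k) e)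
     (0%R, a) ZX)
  (dC : measure_display) (OC : measurableType dC) (PC : probability OC R)
  (ZC : nat -> OC -> 'Z_N)
  (hZC : simple_random_walk PC (@circulant N k) 0%R ZC) :
  let hX := expected_hitting_time PX ZX (l%:R, a) in
  let hC := expected_hitting_time PC ZC l%:R in
  [/\ hX \is a fin_num, hC \is a fin_num &
    (fine hX)%:C =
      (2 * k + r)%:R / (2 * k)%:R * (fine hC)%:C
      - (N * #|V| * (2 * k + r))%:R / 2%:R *
        \sum_(al < t.+1 | (0 < al)%N)
          (vertex_entry (E al) a a)%:C *
          \sum_(c < k)
            1 / (gam al c * (Dpoly k (nu al)%:C)^`().[phi al c]) *
            (Vseq (gam al c) l * Vseq (gam al c) (N - l) / Vseq (gam al c) N)].
Proof.
destruct N as [|[|n]]; [lia|lia|].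
have nu_inj : injective nu.
  move=> al be nuE; apply/val_inj/eqP; apply/negPn/negP.
  by rewrite neq_ltn => /orP[] /hnu_lt; rewrite nuE ltxx.
have nu_gt0 (al : 'I_t.+1) : (0 < al)%N -> 0 < (nu al)%:C.
  by move=> al0; rewrite ltcR -hnu0 hnu_lt.
case: hG => symm _.
have irrC := circulant_irreflexive hk hNk.
have regC := circulant_regular hk hNk.
have cardN : #|'Z_n.+2| = n.+2 by rewrite card_ord.
have [g0 g0E] := laplacian_green_function (circulant_connected n.+2 hk) regC R
  (@circulant_sym n.+2 k) l%:R.
pose g (al : 'I_t.+1) (x : 'Z_n.+2) : R[i] := if al == ord0 then (g0 x)%:C else
  circulant_green n (nu al)%:C (phi al) (rho al) (l%:R - x)%R.
have gE al y : ((2 * k)%:R + (nu al)%:C) * g al y - \sum_(z | circulant k y z) g al z =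
    (y == l%:R)%:R - (al == ord0)%:R / #|'Z_n.+2|%:R.
  rewrite /g; have [->|al0] := eqVneq al ord0.
    rewrite hnu0 addr0 -rmorph_sum -(rmorph_nat (real_complex R) (2 * k)).
    by rewrite -rmorphM -rmorphB g0E rmorphB fmorphV !rmorph_nat mul1r.
  have al_gt0 : (0 < al)%N by rewrite lt0n.
  have roots c : root (Dpoly k (nu al)%:C) (phi al c).
    by apply/(hphi _ al_gt0); exists c.
  have := circulant_greenP hk hNk (nu_gt0 _ al_gt0) (hphi_inj _ al_gt0) roots
    (fun c => hrho0 _ c al_gt0) (fun c => hrho _ c al_gt0) (l%:R - y).
  rewrite -(circulant_sum_reflect hk hNk
    (fun z : 'Z_n.+2 => circulant_green n _ _ _ z)) => ->.
  by rewrite mul0r subr0 subr_eq0 eq_sym.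
have nuP x : eigenvalue (regular_laplacian R e r) x -> exists al, x = nu al.
  by move/hnu.
have k2_gt0 : (0 < 2 * k)%N by rewrite muln_gt0.
have [hX hXE hXC] := hitting_time_green hZX
  (cartesian_product_regular irrC regC hGr) (ltn_addr r k2_gt0)
  (fun p => product_green a p irrC symm hGc hGr hnu0 nu_inj nuP hE gE).
have g0C (x : 'Z_n.+2) : (2 * k)%:R * (g0 x)%:C - \sum_(y | circulant k x y) (g0 y)%:C =
    (x == l%:R)%:R - #|'Z_n.+2|%:R^-1.
  have := gE ord0 x; rewrite hnu0 addr0 eqxx mul1r /g eqxx => <-.
  by [].
have [hC hCE hCC] := hitting_time_green hZC regC k2_gt0 g0C.
have E0 : vertex_entry (E ord0) a a = #|V|%:R^-1.
  by apply: (kernel_projection_entry _ _ symm hGc hGr); rewrite -hnu0.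
have lE : ((l%:R : 'Z_n.+2) : nat) = l by rewrite val_Zp_nat// modn_small//; lia.
have VP : #|V|%:R != 0 :> R[i] by rewrite pnatr_eq0 -lt0n; case: hGc.
have kP : k%:R != 0 :> R[i] by rewrite pnatr_eq0 -lt0n.
move=> hX' hC'; rewrite /hX' /hC' hXE hCE; split=> //.
rewrite -[fine _]/hX -[fine _]/hC hXC hCC card_prod cardN !natrM.
set S := \sum_(al < _ | (0 < al)%N) _.
rewrite [X in _ * X = _](_ : _ =
  #|V|%:R^-1 * ((g0 l%:R)%:C - (g0 0)%:C) - 2%:R^-1 * S); last first.
  rewrite -sumrB (bigD1 ord0)//= /S mulr_sumr -sumrN; congr (_ + _).
    by rewrite /g eqxx -mulrBr E0 fmorphV rmorph_nat.
  apply: eq_big => [al|al al0]; first by rewrite lt0n.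
  have al_gt0 : (0 < al)%N by rewrite lt0n.
  have roots c : root (Dpoly k (nu al)%:C) (phi al c).
    by apply/(hphi _ al_gt0); exists c.
  rewrite -mulrBr /g (negPf al0) subrr subr0 lE.
  rewrite (circulant_green_diff _ (nu_gt0 _ al_gt0) roots
    (fun c => hrho0 _ c al_gt0) (fun c => hrho _ c al_gt0)
    (fun c => heta _ c al_gt0) (fun c => hgam _ c al_gt0)); last by lia.
  by rewrite mulrN mulrCA.
by field; rewrite kP VP.
Qed.
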